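(* There are universal constants $c_0>0$ and $d_0\in\mathbb{N}$ such that the following holds for all $R,\beta>0$. Let $d\ge d_0$ be an integer and let $m$ be an integer satisfying $$1\le m\le\frac d4,\qquad m^3\log(ed)\le c_0 d.$$ Then for every deterministic adaptive algorithm making fewer than $dm/8$ exact-value calls (i.e. with budget $T<dm/8$) there is a function $F\in\mathcal F_\beta(d,R)$ such that the output $\widehat x$ of the algorithm run on $F$ satisfies $$F(\widehat x)-F^\star\ge 2^{-17}\,\frac{\beta R^2}{m^2}.$$ Moreover, $F$ can be taken to be $\beta/(4096m^2)$-strongly convex; in fact, with the global strong-convexity modulus of $F$ equal to $\beta/(4096m^2)$.
   Context: Here $\log$ is the natural logarithm, $\mathbb N$ is the set of positive integers, $\|\cdot\|_2$ is the Euclidean norm on $\mathbb{R}^d$, $B_2^d(r)=\{x\in\mathbb{R}^d:\|x\|_2\le r\}$, and $X:=B_2^d(R)$. ''Universal'' means independent of $d,m,R,\beta$ and of the algorithm. Objective class: $\mathcal F_\beta(d,R)$ is the set of all functions $f:\mathbb{R}^d\to\mathbb{R}$ such that (i) $f$ is convex and continuously differentiable; (ii) $\nabla f$ is globally $\beta$-Lipschitz in Euclidean norm; (iii) $f$ has a unique global minimizer $x_f^\star\in B_2^d(R/2)$. Write $f^\star=\min_x f(x)$. Algorithms: a deterministic adaptive algorithm with budget $T$ (making $T$ calls) consists of Borel maps $Q_t:(X\times\mathbb{R})^{t-1}\to X$, $t=1,\dots,T$, and a Borel terminal map $Q_{\mathrm{out}}:(X\times\mathbb{R})^T\to X$. Run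 on a fixed objective $f$, it recursively produces the queries $x_t=Q_t((x_1,f(x_1)),\dots,(x_{t-1},f(x_{t-1})))$ and the output $\widehat x=Q_{\mathrm{out}}((x_1,f(x_1)),\dots,(x_T,f(x_T)))$. The (global) strong-convexity modulus of $F$ is the largest $\mu\ge0$ such that $x\mapsto F(x)-\frac\mu2\|x\|_2^2$ is convex on $\mathbb{R}^d$. *)

(* Defs.v *)
From HB Require Import structures.
From mathcomp Require Import all_boot all_order all_algebra.
From mathcomp Require Import all_classical all_reals all_analysis.

Set Implicit Arguments.
Unset Strict Implicit.
Unset Printing Implicit Defensive.

Import Order.TTheory GRing.Theory Num.Theory.
Import numFieldNormedType.Exports.

Local Open Scope classical_set_scope.
Local Open Scope ring_scope.

(* The library norm [`|x|] on ['rV_d] is the sup norm, so the Euclidean one is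
   defined separately; both induce the same topology and the same Frechet
   derivative. *)
Definition norm2 (R : realType) (d : nat) (x : 'rV[R]_d) : R :=
  Num.sqrt (\sum_(i < d) x ord0 i ^+ 2).

Definition ball2 (R : realType) (d : nat) (r : R) : set 'rV[R]_d :=
  [set x | norm2 x <= r].
Arguments ball2 {R} d r.

Definition gradient (R : realType) (d : nat) (f : 'rV[R]_d -> R)
    (x : 'rV[R]_d) : 'rV[R]_d :=
  \row_(i < d) 'D_(delta_mx ord0 i) f x.

Definition is_global_minimizer (R : realType) (d : nat) (f : 'rV[R]_d -> R)
    (x : 'rV[R]_d) : Prop :=
  forall y, f x <= f y.

(* Together, [differentiable] everywhere and continuity of [gradient f] say
   that [f] is C^1. *)
Definition objective_class (R : realType) (d : nat) (r beta : R) :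
    set ('rV[R]_d -> R) :=
  [set f |
    [/\ convex_function setT f,
        forall x : 'rV[R]_d, differentiable f x,
        continuous (gradient f),
        forall x y : 'rV[R]_d,
          norm2 (gradient f x - gradient f y) <= beta * norm2 (x - y)
      & exists x : 'rV[R]_d,
          unique (is_global_minimizer f) x /\ ball2 d (r / 2) x] ].
Arguments objective_class {R} d r beta.

Definition strongly_convex (R : realType) (d : nat) (mu : R)
    (f : 'rV[R]_d -> R) : Prop :=
  convex_function setT (fun x : 'rV[R]_d => f x - mu / 2 * norm2 x ^+ 2).

Definition strong_convexity_modulus (R : realType) (d : nat)
    (f : 'rV[R]_d -> R) (mu : R) : Prop :=
  [/\ 0 <= mu, strongly_convex mu f
    & forall nu : R, 0 <= nu -> strongly_convex nu f -> nu <= mu].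

(* Missing in the library; makes histories below pointed topological. *)
HB.instance Definition _ (S T : ptopologicalType) :=
  Pointed.on (S * T)%type.

(* [(R^d * R)^t] with its product topology; the library equips matrices over
   any topological space with the entrywise topology. *)
Notation history R d t := 'rV[('rV[R]_d * R)%type]_t.

(* [(X * R)^t] inside [(R^d * R)^t], for [X] the ball of radius [r]. *)
Definition admissible (R : realType) (d : nat) (r : R) (t : nat) :
    set (history R d t) :=
  [set h | forall i : 'I_t, ball2 d r (h ord0 i).1].
Arguments admissible {R} d r t.

(* A Borel map defined on the subset [D] of [S]; what [f] does outside [D] is
   irrelevant. *)
Definition borel_on (S T : ptopologicalType) (D : set S) (f : S -> T) : Prop :=
  measurable_fun (D : set (g_sigma_algebraType (@open S)))
    (f : g_sigma_algebraType (@open S) -> g_sigma_algebraType (@open T)).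

(* Deterministic adaptive algorithms with [T] exact-value calls on the ball [X]
   of radius [r].  [query t] is the map Q_(t+1) : (X * R)^t -> X, extended
   arbitrarily outside [(X * R)^t]; only [query t] for [t < T] is constrained
   and used. *)
Record algorithm (R : realType) (d : nat) (r : R) (T : nat) := Algorithm {
  query : forall t : nat, history R d t -> 'rV[R]_d;
  output : history R d T -> 'rV[R]_d;
  query_ball : forall t, (t < T)%N ->
    forall h, admissible d r t h -> ball2 d r (query h);
  query_borel : forall t, (t < T)%N ->
    borel_on (admissible d r t) (@query t);
  output_ball : forall h, admissible d r T h -> ball2 d r (output h);
  output_borel : borel_on (admissible d r T) output
}.
Arguments algorithm {R} d r T.

Definition history_rcons (U : Type) (t : nat) (h : 'rV[U]_t) (u : U) :
    'rV[U]_t.+1 :=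
  \row_(i < t.+1) if unlift ord_max i is Some j then h ord0 j else u.

(* The pairs (x_1, f(x_1)), ..., (x_t, f(x_t)), oldest first. *)
Fixpoint transcript (R : realType) (d : nat) (r : R) (T : nat)
    (A : algorithm d r T) (f : 'rV[R]_d -> R) (t : nat) : history R d t :=
  match t with
  | 0 => \row_(i < 0) (0, 0)
  | s.+1 =>
      let h := transcript A f s in
      let x := query A h in
      history_rcons h (x, f x)
  end.

Definition run (R : realType) (d : nat) (r : R) (T : nat)
    (A : algorithm d r T) (f : 'rV[R]_d -> R) : 'rV[R]_d :=
  output A (transcript A f T).

(* Main.v *)
Require Import Defs.
From HB Require Import structures.
From mathcomp Require Import all_boot all_order all_algebra.
From mathcomp Require Import all_classical all_reals all_analysis.
From mathcomp Require Import ring lra zify.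

(** A resisting oracle.  The hard function is a smoothed maximum of the linear
    forms [<v_i, x> + o_i], [i < m], plus a small quadratic, where the [v_i] are
    orthonormal and the offsets [o_i] decrease in steps of [2 delta].  The
    smoothing [max_p (<p, z> - delta / 2 |p|^2)] over the simplex ignores every
    coordinate dominated by [delta].  The vectors are committed one at a time:
    after the [k]-th block of about [d / 8] calls, [v_k] is chosen orthogonal to
    the earlier [v_i] and to the queries of that block, and with inner product
    at most [delta] with all earlier queries.  On the earlier blocks [v_k] is
    then dominated by an earlier vector, and on its own block it contributes the
    value [0], so no answer given so far is affected by the commitment.  Such a
    [v_k] exists because a random signed combination of an orthonormal basis of
    the admissible subspace, of dimension at least [d / 2], has subgaussian
    inner products with the queries; this is where [m ^ 3 log (e d) <= c_0 d]
    enters.  The output is orthogonal to the last vector, so the smoothed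
    maximum is about [0] there, while its regularised minimum is of order
    [- beta r ^ 2 / m ^ 2]. *)

Import Order.TTheory GRing.Theory Num.Theory.
Import numFieldNormedType.Exports.

Local Open Scope classical_set_scope.
Local Open Scope ring_scope.

Set Implicit Arguments.
Unset Strict Implicit.
Unset Printing Implicit Defensive.

(** * The Euclidean inner product on row vectors *)

Section Dot.
Context {R : realType}.

Lemma sum_le_const (n : nat) (f : 'I_n -> R) (a : R) :
  (forall i, f i <= a) -> \sum_i f i <= n%:R * a.
Proof.
move=> fa; apply: le_trans (ler_sum _ (fun i _ => fa i)) _.
by rewrite sumr_const card_ord mulr_natl.
Qed.

Definition dot (d : nat) (x y : 'rV[R]_d) : R := \sum_(i < d) x ord0 i * y ord0 i.

Lemma dotE d (x y : 'rV[R]_d) : dot x y = (x *m y^T) ord0 ord0.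
Proof. by rewrite mxE; apply: eq_bigr => i _; rewrite mxE. Qed.

Lemma dotC d (x y : 'rV[R]_d) : dot x y = dot y x.
Proof. by apply: eq_bigr => i _; rewrite mulrC. Qed.

Lemma dotDl d (x y z : 'rV[R]_d) : dot (x + y) z = dot x z + dot y z.
Proof. by rewrite !dotE mulmxDl mxE. Qed.

Lemma dotZl d a (x y : 'rV[R]_d) : dot (a *: x) y = a * dot x y.
Proof. by rewrite !dotE -scalemxAl mxE. Qed.

Lemma dotNl d (x y : 'rV[R]_d) : dot (- x) y = - dot x y.
Proof. by rewrite -scaleN1r dotZl mulN1r. Qed.

Lemma dotDr d (x y z : 'rV[R]_d) : dot z (x + y) = dot z x + dot z y.
Proof. by rewrite dotC dotDl !(dotC _ z). Qed.

Lemma dotZr d a (x y : 'rV[R]_d) : dot y (a *: x) = a * dot y x.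
Proof. by rewrite dotC dotZl dotC. Qed.

Lemma dotNr d (x y : 'rV[R]_d) : dot y (- x) = - dot y x.
Proof. by rewrite dotC dotNl dotC. Qed.

Definition dot_lin := (@dotDl, @dotDr, @dotZl, @dotZr, @dotNl, @dotNr).

Lemma dot0l d (x : 'rV[R]_d) : dot 0 x = 0.
Proof. by rewrite dotE mul0mx mxE. Qed.

Lemma dot_suml d (I : finType) (P : pred I) (f : I -> 'rV[R]_d) y :
  dot (\sum_(i | P i) f i) y = \sum_(i | P i) dot (f i) y.
Proof.
apply: (big_morph (fun x => dot x y)); [exact: (fun a b => dotDl a b y)|exact: dot0l].
Qed.

Lemma dot_adj d m (x : 'rV[R]_d) (p : 'rV[R]_m) (V : 'M[R]_(m, d)) :
  dot (x *m V^T) p = dot x (p *m V).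
Proof. by rewrite !dotE trmx_mul mulmxA. Qed.

Lemma dot_ge0 d (x : 'rV[R]_d) : 0 <= dot x x.
Proof. by apply: sumr_ge0 => i _; rewrite -expr2 sqr_ge0. Qed.

Lemma norm2E d (x : 'rV[R]_d) : norm2 x = Num.sqrt (dot x x).
Proof. by rewrite /norm2; congr Num.sqrt; apply: eq_bigr => i _; rewrite expr2. Qed.

Lemma norm2_sq d (x : 'rV[R]_d) : norm2 x ^+ 2 = dot x x.
Proof. by rewrite norm2E sqr_sqrtr // dot_ge0. Qed.

Lemma norm2_le d (x : 'rV[R]_d) (a : R) : 0 <= a -> (norm2 x <= a) = (dot x x <= a ^+ 2).
Proof.
by move=> a0; rewrite -norm2_sq ler_sqr ?nnegrE // sqrtr_ge0.
Qed.

Lemma dot_eq0 d (x : 'rV[R]_d) : dot x x = 0 -> x = 0.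
Proof.
move=> /eqP; rewrite /dot psumr_eq0; last by move=> i _; rewrite -expr2 sqr_ge0.
move=> /allP h; apply/rowP => i; rewrite mxE.
by have := h i (mem_index_enum _); rewrite /= mulf_eq0 orbb => /eqP.
Qed.

Lemma dot_young d (q w : 'rV[R]_d) (a : R) : 0 < a ->
  dot q w - a / 2 * dot q q <= dot w w / (2 * a).
Proof.
move=> a0; have := dot_ge0 (a *: q - w).
rewrite !dot_lin (dotC w q) => h; rewrite ler_pdivlMr ?mulr_gt0 //; lra.
Qed.

(** The residual [x - q *m V] of the projection has square [dot x x - dot q q], which is
    nonnegative. *)
Lemma bessel d m (V : 'M[R]_(m, d)) (x : 'rV[R]_d) : V *m V^T = 1%:M ->
  dot (x *m V^T) (x *m V^T) <= dot x x.
Proof.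
move=> VV; set q := x *m V^T; have := dot_ge0 (x - q *m V).
rewrite !dot_lin -(dot_adj x) (dotC (q *m V)) -(dot_adj x q) -/q.
have -> : dot (q *m V) (q *m V) = dot q q.
  by rewrite -dot_adj -mulmxA VV mulmx1.
lra.
Qed.

End Dot.

(** * The smoothed maximum over the simplex and its gradient *)

Section SmoothMax.
Context {R : realType}.
Variables (m : nat) (delta : R).
Hypotheses (m_gt0 : (0 < m)%N) (delta_gt0 : 0 < delta).
Implicit Types z p q : 'rV[R]_m.

Definition simplex : set 'rV[R]_m :=
  [set p | (forall i, 0 <= p ord0 i) /\ \sum_i p ord0 i = 1].

Lemma threshold_exists z : exists t, \sum_i Num.max (z ord0 i - t) 0 = delta.
Proof.
pose M := \sum_i `|z ord0 i|.
have zM i : `|z ord0 i| <= M.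
  by rewrite /M (bigD1 i) //= lerDl sumr_ge0.
have M0 : 0 <= M by rewrite sumr_ge0.
pose f t : R := \sum_i Num.max (z ord0 i - t) 0.
have fc : continuous f.
  apply: (@continuous_big _ _ +%R 0 _ add_continuous R) => i _ t.
  apply: (@continuous_max _ _ (fun x => z ord0 i - x) (cst 0) t); last exact: cst_continuous.
  by apply: continuousB; [exact: cst_continuous|exact: id].
have fM : f M = 0.
  apply: big1 => i _; apply: max_r; rewrite subr_le0.
  by rewrite (le_trans (ler_norm _)).
have fm : delta <= f (- M - delta).
  rewrite /f (bigD1 (Ordinal m_gt0)) //=.
  apply: (@le_trans _ _ (z ord0 (Ordinal m_gt0) - (- M - delta))).
    have := zM (Ordinal m_gt0); rewrite ler_norml => /andP[h1 h2]; lra.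
  rewrite -[X in X <= _]addr0 lerD ?le_max ?lexx // sumr_ge0 // => i _.
  by rewrite le_max lexx orbT.
have le_ab : - M - delta <= M by move: M0 delta_gt0; clear; lra.
have [||t _ ft] := @IVT R f _ _ delta le_ab; last by exists t.
  exact: continuous_subspaceT.
by rewrite fM ge_min le_max fm (ltW delta_gt0) /= orbT.
Qed.

Definition threshold z : R := xget 0 [set t | \sum_i Num.max (z ord0 i - t) 0 = delta].

(** Water-filling form of the Euclidean projection of [z / delta] onto the simplex; this is the
    maximiser of [dot p z - delta / 2 * dot p p], and [smax] is the maximum. *)
Definition weights z : 'rV[R]_m := \row_i (Num.max (z ord0 i - threshold z) 0 / delta).

Definition smax z : R := dot (weights z) z - delta / 2 * dot (weights z) (weights z).

Lemma sum_threshold z : \sum_i Num.max (z ord0 i - threshold z) 0 = delta.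
Proof.
have [t ht] := threshold_exists z.
exact: (@xgetPex _ 0 [set t | _] (ex_intro _ t ht)).
Qed.

Lemma weights_simplex z : simplex (weights z).
Proof.
split=> [i|]; first by rewrite mxE divr_ge0 ?(ltW delta_gt0) // le_max lexx orbT.
under eq_bigr do rewrite mxE.
by rewrite -mulr_suml sum_threshold divff // gt_eqF.
Qed.

(* The variational inequality of the Euclidean projection of [z / delta] onto
   the simplex. *)
Lemma weights_vi z q : simplex q ->
  0 <= dot (z - delta *: weights z) (weights z - q).
Proof.
move=> [q0 q1]; have [p0 p1] := weights_simplex z.
pose t := threshold z.
have -> : dot (z - delta *: weights z) (weights z - q) =
    \sum_i (z ord0 i - t - delta * weights z ord0 i) * (weights z ord0 i - q ord0 i).
  transitivity (dot (z - delta *: weights z) (weights z - q)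
      - t * \sum_i (weights z ord0 i - q ord0 i)).
    by rewrite sumrB p1 q1 subrr mulr0 subr0.
  rewrite mulr_sumr -sumrB; apply: eq_bigr => i _.
  by rewrite !mxE; ring.
apply: sumr_ge0 => i _.
have -> : delta * weights z ord0 i = Num.max (z ord0 i - t) 0.
  by rewrite mxE mulrC divfK // gt_eqF.
(* Each summand is nonnegative: above the threshold the first factor vanishes, below it the weight
   is zero and both factors are nonpositive. *)
have [zt|zt] := leP 0 (z ord0 i - t).
  by rewrite subrr mul0r.
have -> : weights z ord0 i = 0 by rewrite mxE -/t max_r ?mul0r // ltW.
by rewrite subr0 sub0r mulrN -mulNr mulr_ge0 // oppr_ge0 ltW.
Qed.

(** The maximised function is [delta]-strongly concave in [p], so it falls off quadratically away
    from its maximiser [weights z]. *)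
Lemma smax_ge z q : simplex q ->
  dot q z - delta / 2 * dot q q
    + delta / 2 * dot (weights z - q) (weights z - q) <= smax z.
Proof.
move=> /(weights_vi z); rewrite /smax !dot_lin (dotC q (weights z)).
rewrite (dotC z q) (dotC z (weights z)); lra.
Qed.

Lemma smax_ge_simplex z q : simplex q -> dot q z - delta / 2 * dot q q <= smax z.
Proof.
move=> /(smax_ge z); apply: le_trans; rewrite lerDl mulr_ge0 ?dot_ge0 //.
by rewrite divr_ge0 // ltW.
Qed.

Lemma smax_subgradient z z' : smax z + dot (weights z) (z' - z) <= smax z'.
Proof.
have := smax_ge_simplex z' (weights_simplex z); rewrite /smax !dot_lin; lra.
Qed.

(** Strong concavity in [p] turns into smoothness in [z]: the quadratic loss in [smax_ge] pays for
    the change of weights through [dot_young]. *)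
Lemma smax_quadratic z z' :
  smax z' <= smax z + dot (weights z) (z' - z) + dot (z' - z) (z' - z) / (2 * delta).
Proof.
have h := smax_ge z (weights_simplex z').
have h2 := dot_young (weights z' - weights z) (z' - z) delta_gt0.
have e : dot (weights z - weights z') (weights z - weights z') =
    dot (weights z' - weights z) (weights z' - weights z).
  by rewrite -[weights z - _]opprB dotNl dotNr opprK.
rewrite e in h.
suff : smax z' - smax z <= dot (weights z) (z' - z) + (dot (weights z' - weights z) (z' - z)
    - delta / 2 * dot (weights z' - weights z) (weights z' - weights z)) by lra.
move: h; rewrite [smax z']/smax; move: (dot (_ - _) (weights z' - _)) => qq.
rewrite !dot_lin; lra.
Qed.

(** Sum of the two variational inequalities, each tested at the weights of the other point. *)
Lemma weights_cocoercive z z' :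
  delta * dot (weights z - weights z') (weights z - weights z')
    <= dot (weights z - weights z') (z - z').
Proof.
have h1 := weights_vi z (weights_simplex z').
have h2 := weights_vi z' (weights_simplex z).
rewrite -subr_ge0; apply: le_trans (addr_ge0 h1 h2) _.
rewrite le_eqVlt; apply/orP; left; apply/eqP; rewrite !dot_lin.
rewrite !(dotC z) !(dotC z') (dotC (weights z') (weights z)); ring.
Qed.

(* A coordinate dominated by a margin [delta] gets weight zero. *)
Lemma smax_local z z' (j k : 'I_m) :
  (forall i, i != k -> z ord0 i = z' ord0 i) ->
  z ord0 k + delta <= z ord0 j -> z' ord0 k + delta <= z' ord0 j ->
  smax z = smax z'.
Proof.
have half (y y' : 'rV[R]_m) : (forall i, i != k -> y ord0 i = y' ord0 i) ->
    y ord0 k + delta <= y ord0 j -> smax y <= smax y'.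
  move=> yy' yk.
  (* The excess of coordinate [j] over the threshold is at most the total [delta], so the threshold
     is at least [y_j - delta], hence at least [y_k]. *)
  have tk : y ord0 k <= threshold y.
    have := sum_threshold y; rewrite (bigD1 j) //= => e.
    have h : Num.max (y ord0 j - threshold y) 0 <= delta.
      by rewrite -[X in _ <= X]e lerDl sumr_ge0 // => i _; rewrite le_max lexx orbT.
    by move: h; rewrite ge_max => /andP[h _]; lra.
  have w0 : weights y ord0 k = 0 by rewrite mxE max_r ?mul0r // subr_le0.
  (* Having no mass at [k], the weights of [y] give the same value when tried at [y']. *)
  apply: le_trans (smax_ge_simplex y' (weights_simplex y)).
  rewrite /smax lerD2r le_eqVlt; apply/orP; left; apply/eqP.
  apply: eq_bigr => i _; have [->|ik] := eqVneq i k; first by rewrite w0 !mul0r.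
  by rewrite yy'.
move=> e zk z'k; apply/eqP; rewrite eq_le (half z z') ?(half z' z) // => i ik; exact/esym/e.
Qed.

Lemma smax_ge_coord z i : z ord0 i - delta / 2 <= smax z.
Proof.
have s : simplex (delta_mx ord0 i).
  split=> [j|]; first by rewrite mxE ler0n.
  rewrite (bigD1 i) //= big1 ?addr0 ?mxE ?eqxx // => j ji.
  by rewrite mxE (negPf ji) andbF.
have dd (y : 'rV[R]_m) : dot (delta_mx ord0 i) y = y ord0 i.
  rewrite /dot (bigD1 i) //= big1 ?addr0 ?mxE ?eqxx ?mul1r // => j ji.
  by rewrite mxE (negPf ji) andbF mul0r.
by have := smax_ge_simplex z s; rewrite !dd mxE !eqxx mulr1.
Qed.

Lemma smax_le z a : (forall i, z ord0 i <= a) -> smax z <= a.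
Proof.
move=> za; have [p0 p1] := weights_simplex z.
apply: (@le_trans _ _ (dot (weights z) z)).
  by rewrite /smax gerBl mulr_ge0 ?dot_ge0 // divr_ge0 // ltW.
rewrite -[a]mul1r -p1 mulr_suml; apply: ler_sum => i _.
by rewrite ler_wpM2l.
Qed.

(** Optimality condition with multiplier [t]: it turns the variational inequality at [p] into [-
    delta * dot (weights z - p) (weights z - p) >= 0]. *)
Lemma weights_unique z p (t : R) : simplex p ->
  (forall i, z ord0 i = t + delta * p ord0 i) -> weights z = p.
Proof.
move=> [p0 p1] zE; have [w0 w1] := weights_simplex z.
have := weights_vi z (conj p0 p1).
have -> : dot (z - delta *: weights z) (weights z - p) =
    t * \sum_i (weights z ord0 i - p ord0 i) - delta * dot (weights z - p) (weights z - p).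
  rewrite /dot !mulr_sumr -sumrB; apply: eq_bigr => i _.
  by rewrite !mxE zE; ring.
rewrite sumrB w1 p1 subrr mulr0 sub0r oppr_ge0 pmulr_rle0 // => h.
apply/subr0_eq/dot_eq0/eqP; rewrite eq_le h; exact: dot_ge0.
Qed.

End SmoothMax.

(** * Differentiability from quadratic models *)

Section Smoothness.
Context {R : realType}.
Variable d : nat.
Implicit Types (f : 'rV[R]_d -> R) (g : 'rV[R]_d -> 'rV[R]_d).

Lemma convex_function_subgradient f g :
  (forall x y, f x + dot (g x) (y - x) <= f y) -> convex_function setT f.
Proof.
move=> fg t x y _ _.
set w : 'rV[R]_d := conv t x y.
have wE : w = t%:num *: x + (1 - t%:num) *: y by [].
have t0 : 0 <= t%:num by [].
have t1 : 0 <= 1 - t%:num by rewrite subr_ge0.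
have hx := ler_wpM2l t0 (fg w x); have hy := ler_wpM2l t1 (fg w y).
have z : t%:num * dot (g w) (x - w) + (1 - t%:num) * dot (g w) (y - w) = 0.
  rewrite -!dotZr -dotDr.
  suff -> : t%:num *: (x - w) + (1 - t%:num) *: (y - w) = 0 by rewrite dotC dot0l.
  rewrite !scalerBr addrACA -wE -opprD -scalerDl [t%:num + _]addrC subrK scale1r.
  exact: subrr.
move: hx hy z; rewrite -?[conv t (f x : R^o) (f y : R^o)]/(t%:num * f x + (1 - t%:num) * f y).
move: (dot (g w) (x - w)) (dot (g w) (y - w)) => a b; nra.
Qed.

(** With [norm_le_norm2], this moves Euclidean estimates to the sup norm in which limits and
    remainders are expressed. *)
Lemma dot_le_norm (x : 'rV[R]_d) : dot x x <= d%:R * `|x| ^+ 2.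
Proof.
have xi i : x ord0 i ^+ 2 <= `|x| ^+ 2.
  rewrite -[leLHS]real_normK ?num_real // lerXn2r ?nnegrE //.
  by rewrite [leRHS]mx_normrE; exact: (le_bigmax _ (fun ij => `|x ij.1 ij.2|) (ord0, i)).
by apply: sum_le_const => i; rewrite -expr2.
Qed.

Lemma norm_le_norm2 (x : 'rV[R]_d) : `|x| <= norm2 x.
Proof.
have [e|/mx_norm_neq0[[k i] /= e]] := eqVneq (mx_norm x) 0.
  by rewrite [`|x|]e; exact: sqrtr_ge0.
rewrite [`|x|]e norm2E -sqrtr_sqr ler_wsqrtr // /dot ord1 (bigD1 i) //= expr2 lerDl.
by apply: sumr_ge0 => j _; rewrite -expr2 sqr_ge0.
Qed.

Lemma lipschitz_norm2_continuous g (b : R) : 0 <= b ->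
  (forall x y, norm2 (g x - g y) <= b * norm2 (x - y)) -> continuous g.
Proof.
move=> b0 gb x; apply/(@cvgrPdist_le _ _ _ (nbhs x)) => e e0.
pose C := b * Num.sqrt d%:R + 1.
have C0 : 0 < C by rewrite ltr_wpDl // mulr_ge0 // sqrtr_ge0.
have eC : 0 < e / C by rewrite divr_gt0.
have nx : \forall y \near x, `|x - y| <= e / C.
  by apply/nbhs_normP; exists (e / C) => // y /ltW.
near=> y.
have xy : `|x - y| <= e / C by near: y; exact: nx.
apply: le_trans (norm_le_norm2 _) _; apply: le_trans (gb x y) _.
have n2 : norm2 (x - y) <= Num.sqrt d%:R * `|x - y|.
  rewrite norm2_le ?mulr_ge0 ?sqrtr_ge0 // exprMn sqr_sqrtr //.
  exact: dot_le_norm.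
apply: le_trans (ler_wpM2l b0 n2) _; rewrite mulrA.
apply: (@le_trans _ _ (C * `|x - y|)); first by rewrite ler_wpM2r // lerDl.
by rewrite mulrC -ler_pdivlMr.
Unshelve. all: by end_near. Qed.

Lemma dot_continuous (u : 'rV[R]_d) : continuous (dot u).
Proof.
apply: (@continuous_big _ _ +%R 0 _ add_continuous 'rV[R]_d) => i _ x.
apply: (@continuousM _ _ (cst (u ord0 i)) (fun y : 'rV[R]_d => y ord0 i) x).
  exact: cst_continuous.
exact: coord_continuous.
Qed.

(** The remainder of the linear model lies between [0] and [K * dot h h], so it is [o(h)]. *)
Lemma quadratic_model_differentiable f g (K : R) :
  0 <= K ->
  (forall x y, f x + dot (g x) (y - x) <= f y) ->
  (forall x y, f y <= f x + dot (g x) (y - x) + K * dot (y - x) (y - x)) ->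
  forall x, differentiable f x /\ gradient f x = g x.
Proof.
move=> K0 fl fu x.
have lin : linear (dot (g x)).
  by move=> k u v; rewrite !dot_lin.
pose L : {linear 'rV[R]_d -> R} :=
  HB.pack (dot (g x)) (GRing.isLinear.Build _ _ _ _ (dot (g x)) lin).
have Lc : continuous L by exact: dot_continuous.
have e : f \o shift x = cst (f x) + L +o_ 0 id.
  apply/eqaddoP => eps eps0.
  pose C := K * d%:R + 1.
  have C0 : 0 < C by rewrite ltr_wpDl // mulr_ge0.
  have eC : 0 < eps / C by rewrite divr_gt0.
  have nC : \forall h \near (0 : 'rV[R]_d), `|h| <= eps / C.
    exact: (@pseudometric_normed_Zmodule.nbhs0_le _ 'rV[R]_d).
  near=> h.
  have hC : `|h| <= eps / C by near: h; exact: nC.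
  have := fl x (h + x); have := fu x (h + x); rewrite addrK => up lo.
  rewrite /= /cst /= -[(_ - _) h]/(f (h + x) - (f x + dot (g x) h)).
  rewrite ger0_norm ?subr_ge0 //.
  have hh : K * dot h h <= C * `|h| ^+ 2.
    rewrite /C mulrDl mul1r -mulrA (le_trans (ler_wpM2l K0 (dot_le_norm h))) //.
    by rewrite lerDl sqr_ge0.
  have : C * `|h| ^+ 2 <= eps * `|h|.
    by rewrite expr2 mulrA ler_wpM2r // mulrC -ler_pdivlMr.
  lra.
have dL := diff_unique Lc e.
have df : differentiable f x by apply/diff_locallyP; rewrite dL.
split=> //; apply/rowP => i; rewrite mxE deriveE // dL /=.
rewrite /dot (bigD1 i) //= big1 ?addr0 ?mxE ?eqxx ?mulr1 // => j ji.
by rewrite mxE (negPf ji) andbF mulr0.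
Unshelve. all: by end_near. Qed.

End Smoothness.

(** * Unit vectors nearly orthogonal to given points *)

Section NearOrthogonal.
Context {R : realType}.

(** Since [expR (- x) >= 1 - x], the product [expR x * (1 - x)] is at most [1], whereas the right
    side times [1 - x] is at least [1]. *)
Lemma expR_le_quadratic (x : R) : `|x| <= 1 / 2 -> expR x <= 1 + x + 2 * x ^+ 2.
Proof.
rewrite ler_norml => /andP[x1 x2].
have h := expR_ge1Dx (- x).
have e : expR x * expR (- x) = 1 by rewrite expRxMexpNx_1.
have p := expR_gt0 x.
have h2 : expR x * (1 - x) <= 1 by rewrite -[leRHS]e ler_wpM2l ?(ltW p).
rewrite -(ler_pM2r (_ : 0 < 1 - x)); last lra.
apply: le_trans h2 _.
have -> : (1 + x + 2 * x ^+ 2) * (1 - x) = 1 + x ^+ 2 * (1 - 2 * x) by ring.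
by rewrite lerDl mulr_ge0 ?sqr_ge0 //; lra.
Qed.

(* From [|x| <= 1/2] the bound propagates by [cosh (2x) = 2 cosh x ^ 2 - 1]. *)
Lemma cosh_le_gauss (x : R) : (expR x + expR (- x)) / 2 <= expR (2 * x ^+ 2).
Proof.
have step (y : R) : (expR y + expR (- y)) / 2 <= expR (2 * y ^+ 2) ->
    (expR (2 * y) + expR (- (2 * y))) / 2 <= expR (2 * (2 * y) ^+ 2).
  have -> : 2 * (2 * y) ^+ 2 = 2 * y ^+ 2 * 4%:R by ring.
  have -> : - (2 * y) = - y * 2%:R by ring.
  have -> : 2 * y = y * 2%:R by ring.
  rewrite (expRM_natr 4) (expRM_natr 2 y) (expRM_natr 2 (- y)).
  have e : expR y * expR (- y) = 1 by rewrite expRxMexpNx_1.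
  have := expR_gt0 y; have := expR_gt0 (- y).
  move: (expR y) (expR (- y)) (expR (2 * y ^+ 2)) e => a b c e b0 a0 h.
  have h2 : ((a + b) / 2) ^+ 2 <= c ^+ 2 by rewrite lerXn2r ?nnegrE //; lra.
  have h4 := sqr_ge0 (c ^+ 2 - 1).
  have -> : (a ^+ 2 + b ^+ 2) / 2 = 2 * ((a + b) / 2) ^+ 2 - 1.
    by rewrite -[X in _ - X]e; field.
  have -> : c ^+ 4 = (c ^+ 2 - 1) ^+ 2 + 2 * c ^+ 2 - 1 by ring.
  lra.
have base (y : R) : `|y| <= 1 / 2 -> (expR y + expR (- y)) / 2 <= expR (2 * y ^+ 2).
  move=> y1; have h1 := expR_le_quadratic y1.
  have := @expR_le_quadratic (- y); rewrite normrN => /(_ y1) h2.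
  have := expR_ge1Dx (2 * y ^+ 2); lra.
have iter n : forall y : R, `|y| <= 2 ^+ n / 2 ->
    (expR y + expR (- y)) / 2 <= expR (2 * y ^+ 2).
  elim: n => [|n IH] y hy; first exact: base.
  have -> : y = 2 * (y / 2) by field.
  apply/step/IH; rewrite normrM normfV (ger0_norm (ler0n _ 2)) .
  by move: hy; rewrite exprS; lra.
(* Enough doublings: [2 * |x| < n <= 2 ^ n]. *)
pose n := Num.bound (2 * `|x|).
apply: (iter n); rewrite ler_pdivlMr // mulrC.
have := archi_boundP (mulr_ge0 (ler0n R 2) (normr_ge0 x)); rewrite -/n => /ltW/le_trans; apply.
by rewrite -natrX ler_nat ltnW // ltn_expl.
Qed.

(* Method of conditional expectations for the exponential moments of random
   signs. *)
Lemma signs_exp_moment (N D : nat) (a : 'I_N -> nat -> R) (w : 'I_N -> R) :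
  (forall j, 0 <= w j) ->
  exists e : nat -> R, (forall i, e i ^+ 2 = 1) /\
    \sum_j w j * expR (\sum_(i < D) e i * a j i)
      <= \sum_j w j * expR (2 * \sum_(i < D) a j i ^+ 2).
Proof.
elim: D w => [|D IH] w w0.
  exists (fun=> 1); split=> [i|]; first by rewrite expr1n.
  by apply: ler_sum => j _; rewrite !big_ord0 mulr0.
(* The weights absorb the bound for the last sign, which is chosen only after the first [D]
   signs. *)
have [|e [e1 he]] := IH (fun j => w j * expR (2 * a j D ^+ 2)).
  by move=> j; rewrite mulr_ge0 // expR_ge0.
pose S s := \sum_j w j * expR (\sum_(i < D) e i * a j i) * expR (s * a j D).
have avg : (S 1 + S (-1)) / 2 <= \sum_j w j * expR (2 * \sum_(i < D.+1) a j i ^+ 2).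
  rewrite /S -big_split /= mulr_suml.
  have {}he : \sum_j w j * expR (\sum_(i < D) e i * a j i) * expR (2 * a j D ^+ 2)
      <= \sum_j w j * expR (2 * \sum_(i < D.+1) a j i ^+ 2).
    apply: le_trans (_ : _ <= _); last first.
      apply: le_trans he _; apply: ler_sum => j _.
      by rewrite -mulrA -expRD -mulrDr [in leRHS]big_ord_recr /= addrC.
    by apply: ler_sum => j _; rewrite mulrAC.
  apply: le_trans he; apply: ler_sum => j _.
  rewrite -mulrDr -mulrA ler_wpM2l ?mulr_ge0 ?expR_ge0 //.
  by rewrite mul1r mulN1r cosh_le_gauss.
(* The better of the two signs does no worse than their average. *)
have [s [s1 hs]] : exists s : R, s ^+ 2 = 1 /\ S s <= (S 1 + S (-1)) / 2.
  have [h|h] := leP (S 1) (S (-1)); [exists 1|exists (-1)]; split;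
    rewrite ?sqrrN ?expr1n //; lra.
exists (fun i => if i == D then s else e i); split=> [i|]; first by case: ifP.
apply: le_trans avg; apply: le_trans hs; rewrite /S.
apply: ler_sum => j _; rewrite -mulrA -expRD big_ord_recr /= eqxx.
rewrite (eq_bigr (fun i : 'I_D => e i * a j i)) ?lexx // => i _.
by rewrite ltn_eqF.
Qed.

Variable d : nat.
Implicit Types (s : seq 'rV[R]_d) (u : nat -> 'rV[R]_d).

Lemma orthogonal_unit s : (size s < d)%N ->
  exists u : 'rV[R]_d, dot u u = 1 /\ {in s, forall x, dot u x = 0}.
Proof.
move=> sd; pose A : 'M[R]_(d, size s) := \matrix_(i, j) s`_j ord0 i.
have : kermx A != 0.
  by rewrite kermx_eq0 /row_free neq_ltn (leq_ltn_trans (rank_leq_col A) sd).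
move=> /rowV0Pn[v /sub_kermxP vA v0].
have vv : 0 < dot v v.
  by rewrite lt_def dot_ge0 andbT; apply: contraNneq v0 => /dot_eq0 ->.
exists ((Num.sqrt (dot v v))^-1 *: v); split.
  rewrite !dot_lin mulrA -invfM -expr2 sqr_sqrtr ?ltW // mulVf // gt_eqF //.
move=> x /(nthP 0)[j js <-].
have := congr1 (fun M : 'rV[R]_(size s) => M ord0 (Ordinal js)) vA.
rewrite !mxE /= => h.
have vj : dot v s`_j = 0 by rewrite -h; apply: eq_bigr => i _; rewrite mxE.
by rewrite dotZl vj mulr0.
Qed.

Definition orthonormal_upto (D : nat) u :=
  forall i j, (i < D)%N -> (j < D)%N -> dot (u i) (u j) = (i == j)%:R.

(** Each new unit vector joins the list that the remaining ones must avoid, so the dimension count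
    is preserved. *)
Lemma orthonormal_complement D s : (D + size s <= d)%N ->
  exists u, orthonormal_upto D u /\ forall i, (i < D)%N -> {in s, forall x, dot (u i) x = 0}.
Proof.
elim: D s => [|D IH] s Ds; first by exists (fun=> 0).
have [|v [v1 vs]] := @orthogonal_unit s.
  by rewrite (leq_trans _ Ds) // addSn ltnS leq_addl.
have [|u [uo us]] := IH (v :: s); first by rewrite /= addnS.
have uv i : (i < D)%N -> dot (u i) v = 0 by move=> iD; apply: us; rewrite ?mem_head.
exists (fun i => if i == D then v else u i); split=> [i j|i].
  rewrite !ltnS (leq_eqVlt i) (leq_eqVlt j).
  case: (eqVneq i D) => [->|iD] /=; case: (eqVneq j D) => [->|jD] //=.
  - by move=> _ jD'; rewrite dotC uv.
  - by move=> iD' _; rewrite uv // (negPf iD).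
  - exact: uo.
rewrite ltnS leq_eqVlt; case: (eqVneq i D) => [_ _|_ /= iD] //.
by move=> x xs; apply: us; rewrite ?in_cons ?xs ?orbT.
Qed.

Lemma orthonormal_bessel D u (x : 'rV[R]_d) : orthonormal_upto D u ->
  \sum_(i < D) dot (u i) x ^+ 2 <= dot x x.
Proof.
move=> uo; pose V : 'M[R]_(D, d) := \matrix_(i < D) u i.
have VV : V *m V^T = 1%:M.
  apply/matrixP => i j; rewrite !mxE -(uo i j) // /dot.
  by apply: eq_bigr => k _; rewrite !mxE.
apply: le_trans (bessel x VV); rewrite le_eqVlt; apply/orP; left; apply/eqP.
apply: eq_bigr => i _; rewrite -expr2; congr (_ ^+ 2).
by rewrite mxE /dot; apply: eq_bigr => k _; rewrite !mxE mulrC.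
Qed.

(* Take [v = D^(-1/2) (sum_i e_i u_i)] with signs [e] chosen through
   the exponential moment, at [lambda = eta D / (4 r^2)]. *)
Lemma near_orthogonal_unit (D N : nat) s (x : 'I_N -> 'rV[R]_d) (r eta : R) :
  (0 < D)%N -> (D + size s <= d)%N -> 0 < r -> 0 < eta ->
  (forall j, dot (x j) (x j) <= r ^+ 2) ->
  N%:R * expR (- (eta ^+ 2 * D%:R / (8 * r ^+ 2))) < 1 ->
  exists v : 'rV[R]_d, [/\ dot v v = 1, {in s, forall y, dot v y = 0}
    & forall j, dot v (x j) <= eta].
Proof.
move=> D0 Ds r0 eta0 xr hN.
have [u [uo us]] := orthonormal_complement Ds.
have D0' : 0 < D%:R :> R by rewrite ltr0n.
pose c : R := (Num.sqrt D%:R)^-1.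
have c2 : c ^+ 2 = D%:R^-1 by rewrite /c exprVn sqr_sqrtr // ltW.
(* This value minimises the exponent [2 * lam ^+ 2 * r ^+ 2 / D - lam * eta]. *)
pose lam := eta * D%:R / (4 * r ^+ 2).
have lam0 : 0 < lam by rewrite divr_gt0 ?mulr_gt0 ?exprn_gt0.
have [|e [e1 he]] := @signs_exp_moment N D (fun j i => lam * c * dot (u i) (x j)) (fun=> 1).
  by move=> _; exact: ler01.
pose v := c *: \sum_(i < D) e i *: u i.
have vx y : dot v y = c * \sum_(i < D) e i * dot (u i) y.
  by rewrite /v dotZl dot_suml; under eq_bigr do rewrite dotZl.
have vu (i : 'I_D) : dot (u i) v = c * e i.
  rewrite dotC vx (bigD1 i) //= big1 ?addr0 ?uo // ?eqxx ?mulr1 // => j ji.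
  by rewrite uo // (negPf (ji : (j : nat) != i)) mulr0.
exists v; split.
- rewrite vx; under eq_bigr do rewrite vu mulrCA -expr2 e1 mulr1.
  by rewrite sumr_const card_ord -mulr_natr mulrA -expr2 c2 mulVf // gt_eqF.
- move=> y ys; rewrite vx big1 ?mulr0 // => i _.
  by rewrite us // mulr0.
move=> j; rewrite leNgt; apply/negP => lt_eta.
(* A single violated bound already makes its own term exceed [expR (lam * eta)]; Bessel's inequality
   bounds the whole sum in [up], and [hN] makes the two incompatible. *)
have lo : expR (lam * eta) < \sum_j 1 * expR (\sum_(i < D) e i * (lam * c * dot (u i) (x j))).
  rewrite (bigD1 j) //= mul1r; apply: ltr_wpDr.
    by apply: sumr_ge0 => k _; rewrite mul1r expR_ge0.
  rewrite ltr_expR.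
  have -> : \sum_(i < D) e i * (lam * c * dot (u i) (x j)) = lam * dot v (x j).
    by rewrite vx mulrA mulr_sumr; apply: eq_bigr => i _; ring.
  by rewrite ltr_pM2l.
have up : \sum_j 1 * expR (2 * \sum_(i < D) (lam * c * dot (u i) (x j)) ^+ 2)
    <= N%:R * expR (2 * lam ^+ 2 * r ^+ 2 / D%:R).
  apply: sum_le_const => k; rewrite mul1r ler_expR.
  under eq_bigr do rewrite exprMn exprMn c2.
  rewrite -mulr_sumr.
  have h := le_trans (orthonormal_bessel (x k) uo) (xr k).
  have -> : 2 * lam ^+ 2 * r ^+ 2 / D%:R = 2 * (lam ^+ 2 / D%:R * r ^+ 2) by ring.
  rewrite ler_pM2l // ler_wpM2l //.
  by rewrite mulr_ge0 ?invr_ge0 ?(ltW D0') ?sqr_ge0.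
have := lt_le_trans lo (le_trans he up).
apply/negP; rewrite -leNgt.
have -> : 2 * lam ^+ 2 * r ^+ 2 / D%:R = lam * eta - eta ^+ 2 * D%:R / (8 * r ^+ 2).
  by rewrite /lam; field; rewrite !gt_eqF.
rewrite expRD mulrCA -[leRHS]mulr1 ler_pM2l ?expR_gt0 //; exact: ltW.
Qed.

End NearOrthogonal.

(** * The hard function *)

Section HardFunction.
Context {R : realType}.
Variables (d m : nat) (delta L mu : R).
Hypotheses (m_gt0 : (0 < m)%N) (delta_gt0 : 0 < delta).
Implicit Types (v : nat -> 'rV[R]_d) (x y : 'rV[R]_d).

Definition frame v : 'M[R]_(m, d) := \matrix_(i < m) v i.

(** Indices start at [0], so the last offset, that of [v m.-1], is exactly [0]. *)
Definition offsets : 'rV[R]_m := \row_i ((m - i.+1)%:R * (2 * delta)).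

Definition coords v x : 'rV[R]_m := x *m (frame v)^T + offsets.

Definition hard v x : R := L * smax delta (coords v x) + mu / 2 * dot x x.

Definition hard_grad v x : 'rV[R]_d :=
  L *: (weights delta (coords v x) *m frame v) + mu *: x.

Lemma coordsE v x (i : 'I_m) :
  coords v x ord0 i = dot (v i) x + (m - i.+1)%:R * (2 * delta).
Proof.
rewrite !mxE; congr (_ + _); apply: eq_bigr => k _.
by rewrite !mxE mulrC.
Qed.

Lemma frame_orthonormal v : orthonormal_upto m v -> frame v *m (frame v)^T = 1%:M.
Proof.
move=> vo; apply/matrixP => i j; rewrite !mxE -(vo i j) //.
by apply: eq_bigr => k _; rewrite !mxE.
Qed.

Lemma coordsB v x y : coords v y - coords v x = (y - x) *m (frame v)^T.
Proof. by rewrite /coords mulmxBl opprD addrACA subrr addr0. Qed.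

(** Consecutive offsets differ by [2 * delta]; an inner product of at most [delta] uses up half of
    this gap, and the other half is the margin required by [smax_local]. *)
Lemma hard_local v v' x (j k : nat) : (j < k < m)%N ->
  (forall i, i != k -> v i = v' i) -> dot (v j) x = 0 ->
  dot (v k) x <= delta -> dot (v' k) x <= delta -> hard v x = hard v' x.
Proof.
move=> /andP[jk km] vv' vj vk v'k.
suff e : smax delta (coords v x) = smax delta (coords v' x) by rewrite /hard e.
have jm := ltn_trans jk km.
have gap : (m - k.+1)%:R * (2 * delta) + 2 * delta <= (m - j.+1)%:R * (2 * delta).
  rewrite -[X in _ + X <= _]mul1r -mulrDl ler_pM2r ?mulr_gt0 //.
  rewrite natr1 ler_nat; lia.
apply: (@smax_local _ _ _ m_gt0 delta_gt0 _ _ (Ordinal jm) (Ordinal km)) => [i ik||].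
- by rewrite !coordsE vv'.
- rewrite !coordsE /= vj; lra.
- rewrite !coordsE /= -(vv' j) ?ltn_eqF // vj; lra.
Qed.

Lemma hard_eq v v' x : (forall i, dot (v i) x = dot (v' i) x) -> hard v x = hard v' x.
Proof.
move=> e; suff ec : coords v x = coords v' x by rewrite /hard ec.
by apply/rowP => i; rewrite !coordsE e.
Qed.

Hypotheses (L_gt0 : 0 < L) (mu_gt0 : 0 < mu).

Lemma hard_subgradient v x y :
  hard v x + dot (hard_grad v x) (y - x) + mu / 2 * dot (y - x) (y - x) <= hard v y.
Proof.
have := smax_subgradient m_gt0 delta_gt0 (coords v x) (coords v y).
rewrite coordsB dotC dot_adj dotC => /(ler_wpM2l (ltW L_gt0)).
rewrite /hard /hard_grad; move: (weights _ _ *m _) (smax _ _) (smax _ _) => g a b.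
rewrite !dot_lin (dotC y x); lra.
Qed.

Section Orthonormal.
Variable v : nat -> 'rV[R]_d.
Hypothesis v_orth : orthonormal_upto m v.

Lemma hard_quadratic x y :
  hard v y <= hard v x + dot (hard_grad v x) (y - x)
    + (L / delta + mu) / 2 * dot (y - x) (y - x).
Proof.
have h : smax delta (coords v y) <= smax delta (coords v x)
    + dot (weights delta (coords v x) *m frame v) (y - x) + dot (y - x) (y - x) / (2 * delta).
  apply: le_trans (smax_quadratic m_gt0 delta_gt0 (coords v x) (coords v y)) _.
  rewrite coordsB (dotC (weights _ _)) dot_adj (dotC _ (y - x)) lerD2l.
  by rewrite ler_pM2r ?invr_gt0 ?mulr_gt0 // bessel // frame_orthonormal.
move: h => /(ler_wpM2l (ltW L_gt0)).
have -> : (L / delta + mu) / 2 * dot (y - x) (y - x) =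
    L * (dot (y - x) (y - x) / (2 * delta)) + mu / 2 * dot (y - x) (y - x).
  by field; rewrite gt_eqF.
rewrite /hard /hard_grad; move: (weights _ _ *m _) (smax _ _) (smax _ _) => g a b.
move: (dot (y - x) (y - x) / (2 * delta)) => q.
rewrite !dot_lin (dotC y x); lra.
Qed.

(** Cocoercivity passes from the weights to [g = q *m frame v] because the frame is isometric; then
    every term of the expanded square is bounded by a multiple of [dot w w]. *)
Lemma hard_grad_lipschitz x y :
  norm2 (hard_grad v x - hard_grad v y) <= (L / delta + mu) * norm2 (x - y).
Proof.
have b0 : 0 <= L / delta + mu by rewrite addr_ge0 ?divr_ge0 ?ltW.
rewrite norm2_le ?mulr_ge0 ?sqrtr_ge0 // exprMn norm2_sq.
set w := x - y.
set q := weights delta (coords v x) - weights delta (coords v y).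
have -> : hard_grad v x - hard_grad v y = L *: (q *m frame v) + mu *: w.
  by rewrite /hard_grad /q /w mulmxBl !scalerBr opprD addrACA.
have gg : dot (q *m frame v) (q *m frame v) = dot q q.
  by rewrite -dot_adj -mulmxA frame_orthonormal // mulmx1.
have := weights_cocoercive m_gt0 delta_gt0 (coords v x) (coords v y).
rewrite -/q coordsB (dotC q) dot_adj -gg dotC -/w.
move: (q *m frame v) => g; clear gg q; move: w => w co.
(* In place of Cauchy-Schwarz: this square and [delta * G <= S] together give [delta * S <= W]. *)
have yg := dot_ge0 (delta *: g - w); rewrite !dot_lin (dotC w g) in yg.
have G0 := dot_ge0 g; rewrite !dot_lin (dotC w g).
move: (dot g g) (dot g w) (dot w w) G0 co yg => G S W G0 co yg.
have S0 : 0 <= S by apply: le_trans co; rewrite mulr_ge0 // ltW.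
have dS : delta * S <= W.
  have := ler_wpM2l (ltW delta_gt0) co; lra.
have SW : S <= W / delta by rewrite ler_pdivlMr // mulrC.
have GS : G <= S / delta by rewrite ler_pdivlMr // mulrC.
have GW : G <= W / delta / delta.
  by apply: le_trans GS _; rewrite ler_pM2r ?invr_gt0.
have -> : (L / delta + mu) ^+ 2 * W =
    L ^+ 2 * (W / delta / delta) + 2 * (L * mu) * (W / delta) + mu ^+ 2 * W.
  by field; rewrite gt_eqF.
have h1 := ler_wpM2l (sqr_ge0 L) GW.
have h2 : 2 * (L * mu) * S <= 2 * (L * mu) * (W / delta).
  by rewrite ler_wpM2l // mulr_ge0 // mulr_ge0 // ltW.
lra.
Qed.

Lemma hard_differentiable x : differentiable (hard v) x /\ gradient (hard v) x = hard_grad v x.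
Proof.
apply: (quadratic_model_differentiable _ _ hard_quadratic).
  by rewrite divr_ge0 // addr_ge0 ?divr_ge0 ?ltW.
move=> {}x y; apply: le_trans (hard_subgradient v x y).
by rewrite lerDl mulr_ge0 ?dot_ge0 // divr_ge0 // ltW.
Qed.

Lemma hard_strongly_convex : strongly_convex mu (hard v).
Proof.
rewrite /strongly_convex.
rewrite (_ : (fun x => _) = (fun x => L * smax delta (coords v x))); last first.
  by apply/funext => x; rewrite norm2_sq /hard addrK.
apply: (@convex_function_subgradient _ _ _
  (fun x => L *: (weights delta (coords v x) *m frame v))) => x y.
have := smax_subgradient m_gt0 delta_gt0 (coords v x) (coords v y).
rewrite coordsB dotC dot_adj dotC => /(ler_wpM2l (ltW L_gt0)).
by rewrite mulrDr dotZl.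
Qed.

(* Along a direction orthogonal to all [v i] the function is exactly
   [mu / 2 * t ^ 2] plus a constant. *)
Lemma hard_modulus : (m < d)%N -> strong_convexity_modulus (hard v) mu.
Proof.
move=> md; split; [exact: ltW|exact: hard_strongly_convex|move=> nu nu0 nuc].
have [|u [u1 us]] := @orthogonal_unit _ d [seq v i | i <- iota 0 m].
  by rewrite size_map size_iota.
have vu (i : 'I_m) : dot (v i) u = 0.
  by rewrite dotC; apply/us/map_f; rewrite mem_iota ltn_ord.
have t0 : 0 <= (1 / 2 : R) by lra.
have t1 : (1 / 2 : R) <= 1 by lra.
(* Convexity is tested at [0], the midpoint of [u] and [- u]; the smoothed maximum takes the same
   value at all three points. *)
have := nuc (Itv01 t0 t1) u (- u).
rewrite !inE => /(_ Logic.I Logic.I).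
set w := conv _ _ _; have -> : w = 0.
  rewrite /w -[conv _ _ _]/((1 / 2) *: u + (1 - 1 / 2) *: - u).
  by rewrite (_ : 1 - 1 / 2 = 1 / 2 :> R) ?scalerN ?subrr //; lra.
move=> key.
have {key} : hard v 0 - nu / 2 * norm2 (0 : 'rV[R]_d) ^+ 2 <=
    1 / 2 * (hard v u - nu / 2 * norm2 u ^+ 2)
    + (1 - 1 / 2) * (hard v (- u) - nu / 2 * norm2 (- u) ^+ 2) by exact: key.
rewrite !norm2_sq.
have cE y : (forall i : 'I_m, dot (v i) y = 0) -> coords v y = coords v 0.
  by move=> vy; apply/rowP => i; rewrite !coordsE vy dotC dot0l.
rewrite /hard !cE => [|i|i]; rewrite ?dotNr ?vu ?oppr0 //.
rewrite !dot_lin dot0l u1; lra.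
Qed.

(** The offsets move the uniform weights by at most [2 * m * delta / (L / mu)]; this keeps the shift
    within [1 / m], so that [min_weights] is nonnegative. *)
Hypothesis d_gap : 2 * m%:R ^+ 2 * delta <= L / mu.

Definition mean_offset : R := (\sum_i offsets ord0 i) / m%:R.

(** Stationarity forces [x = - (L / mu) *: (p *m frame v)], where the coordinates are
    [offsets - (L / mu) * p]. Equating them to [t + delta * p] with total weight [1] gives this
    [p]. *)
Definition min_weights : 'rV[R]_m :=
  \row_i (1 / m%:R + (offsets ord0 i - mean_offset) / (delta + L / mu)).

Definition hard_min : 'rV[R]_d := - (L / mu) *: (min_weights *m frame v).

Let mR : 0 < m%:R :> R. Proof. by rewrite ltr0n. Qed.
Let Lmu : 0 < L / mu. Proof. exact: divr_gt0. Qed.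

Lemma offsets_bounds i : 0 <= offsets ord0 i <= 2 * m%:R * delta.
Proof.
rewrite mxE; apply/andP; split; first by rewrite mulr_ge0 // mulr_ge0 // ltW.
rewrite mulrCA mulrA ler_pM2r // ler_pM2l // ler_nat; exact: leq_subr.
Qed.

Lemma mean_offset_bounds : 0 <= mean_offset <= 2 * m%:R * delta.
Proof.
apply/andP; split.
  by rewrite divr_ge0 ?ler0n // sumr_ge0 // => i _; case/andP: (offsets_bounds i).
rewrite ler_pdivrMr // mulrC; apply: sum_le_const => i.
by case/andP: (offsets_bounds i).
Qed.

Lemma min_weights_dev i : `|min_weights ord0 i - 1 / m%:R| <= 2 * m%:R * delta / (L / mu).
Proof.
rewrite mxE addrAC subrr add0r normrM normfV.
have D0 : 0 < delta + L / mu by rewrite addr_gt0.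
rewrite (gtr0_norm D0); apply: ler_pM; rewrite ?normr_ge0 ?invr_ge0 ?(ltW D0) //.
  have /andP[a1 a2] := offsets_bounds i; have /andP[b1 b2] := mean_offset_bounds.
  rewrite ler_norml; apply/andP; split; lra.
by rewrite lef_pV2 ?posrE // lerDr ltW.
Qed.

Lemma min_weights_simplex : simplex min_weights.
Proof.
split=> [i|].
  have := min_weights_dev i; rewrite ler_norml => /andP[h _].
  have h2 : 2 * m%:R * delta / (L / mu) <= 1 / m%:R.
    rewrite ler_pdivrMr // [leRHS]mulrAC ler_pdivlMr // mul1r.
    by apply: le_trans d_gap; rewrite le_eqVlt; apply/orP; left; apply/eqP; ring.
  lra.
under eq_bigr do rewrite mxE.
rewrite big_split /= -[X in _ + X]mulr_suml sumrB !sumr_const !card_ord.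
rewrite -[mean_offset *+ m]mulr_natr /mean_offset divfK ?gt_eqF // subrr mul0r addr0.
by rewrite -(mulr_natr (1 / m%:R)) div1r mulVf // gt_eqF.
Qed.

Lemma offsetsE i :
  offsets ord0 i = mean_offset + (delta + L / mu) * (min_weights ord0 i - 1 / m%:R).
Proof.
have -> : min_weights ord0 i = 1 / m%:R + (offsets ord0 i - mean_offset) / (delta + L / mu).
  by rewrite mxE.
have D0 : delta + L / mu != 0 by rewrite gt_eqF // addr_gt0.
rewrite addrAC subrr add0r; move: (delta + _) (offsets _ _) mean_offset D0 => D o a D0.
by rewrite mulrC divfK // addrC subrK.
Qed.

Lemma hard_grad_min : hard_grad v hard_min = 0.
Proof.
have wE : weights delta (coords v hard_min) = min_weights.
  (* The multiplier is what remains of [offsetsE] after subtracting [(L / mu) * p] and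
     [delta * p]. *)
  apply: (@weights_unique _ _ _ m_gt0 delta_gt0 _ _
    (mean_offset - (delta + L / mu) / m%:R) min_weights_simplex) => i.
  rewrite /coords /hard_min -scalemxAl -mulmxA frame_orthonormal // mulmx1.
  rewrite mxE [X in X + _]mxE offsetsE; move: (min_weights ord0 i) mean_offset => p o.
  by field; rewrite !gt_eqF.
rewrite /hard_grad wE /hard_min scalerA mulrN mulrCA divff ?gt_eqF // mulr1.
by rewrite scaleNr subrr.
Qed.

Lemma hard_min_lt y : hard v hard_min + mu / 2 * dot (y - hard_min) (y - hard_min) <= hard v y.
Proof. by have := hard_subgradient v hard_min y; rewrite hard_grad_min dot0l addr0. Qed.

Lemma hard_min_minimizer : is_global_minimizer (hard v) hard_min.
Proof.
move=> y; apply: le_trans (hard_min_lt y).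
by rewrite lerDl mulr_ge0 ?dot_ge0 // divr_ge0 // ltW.
Qed.

Lemma hard_min_unique y : is_global_minimizer (hard v) y -> hard_min = y.
Proof.
move=> /(_ hard_min) h; have h2 := hard_min_lt y.
apply/eqP; rewrite eq_sym -subr_eq0; apply/eqP/dot_eq0/eqP.
rewrite eq_le dot_ge0 andbT -(pmulr_rle0 _ (_ : 0 < mu / 2)) ?divr_gt0 //; lra.
Qed.

Lemma hard_min_dot (a : R) : (forall i, min_weights ord0 i <= a) ->
  dot hard_min hard_min <= (L / mu) ^+ 2 * (m%:R * a ^+ 2).
Proof.
move=> pa; have [p0 _] := min_weights_simplex.
rewrite /hard_min !dot_lin -dot_adj -mulmxA frame_orthonormal // mulmx1.
rewrite mulrA mulrNN -expr2 ler_wpM2l ?sqr_ge0 //.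
apply: sum_le_const => i.
by rewrite expr2 ler_pM.
Qed.

(** At [x] the last coordinate is [0], so the smoothed maximum is at least [- delta / 2]. The
    minimum is bounded above by the value at [- s] times the sum of the [v i]; the parameter [s] is
    left free for optimisation. *)
Lemma hard_gap x (s : R) : dot (v m.-1) x = 0 -> 0 <= s ->
  L * s - L * delta * (2 * m%:R + 1 / 2) - mu / 2 * (m%:R * s ^+ 2)
    <= hard v x - hard v hard_min.
Proof.
move=> vx s0.
have hx : - (L * delta / 2) <= hard v x.
  have pm : (m.-1 < m)%N by rewrite prednK.
  have := smax_ge_coord m_gt0 delta_gt0 (coords v x) (Ordinal pm).
  rewrite coordsE /= vx prednK // subnn mul0r addr0 sub0r => /(ler_wpM2l (ltW L_gt0)).
  have : 0 <= mu / 2 * dot x x by rewrite mulr_ge0 ?dot_ge0 // divr_ge0 // ltW.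
  rewrite /hard; lra.
pose y := - s *: ((const_mx 1 : 'rV[R]_m) *m frame v).
have hy : hard v y <= L * (2 * m%:R * delta - s) + mu / 2 * (m%:R * s ^+ 2).
  rewrite /hard lerD //.
    rewrite ler_pM2l // smax_le // => i.
    rewrite /coords /y -scalemxAl -mulmxA frame_orthonormal // mulmx1.
    have /andP[_ ob] := offsets_bounds i.
    have e : (- s *: (const_mx 1 : 'rV[R]_m)) ord0 i = - s by rewrite !mxE mulr1.
    rewrite mxE e; lra.
  rewrite ler_pM2l ?divr_gt0 // /y !dot_lin -dot_adj -mulmxA frame_orthonormal // mulmx1.
  rewrite mulrA mulrNN -expr2 mulrC le_eqVlt; apply/orP; left; apply/eqP; congr (_ * _).
  rewrite /dot; under eq_bigr do rewrite !mxE mulr1.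
  by rewrite sumr_const card_ord.
have := hard_min_minimizer y; lra.
Qed.

End Orthonormal.

End HardFunction.

(** * The resisting oracle *)

Section Transcripts.
Context {R : realType}.
Variables (d T : nat) (r : R) (A : algorithm d r T).

Definition query_at (f : 'rV[R]_d -> R) (t : nat) : 'rV[R]_d := query A (transcript A f t).

Lemma transcript_eq f g t :
  (forall s, (s < t)%N -> f (query_at f s) = g (query_at f s)) ->
  transcript A f t = transcript A g t.
Proof.
elim: t => [//|t IH] fg /=; have e : transcript A f t = transcript A g t.
  by apply: IH => s st; apply: fg; rewrite ltnS ltnW.
by have := fg t (ltnSn t); rewrite /query_at -e => ->.
Qed.

Lemma transcript_admissible f t : (t <= T)%N -> admissible d r t (transcript A f t).
Proof.
elim: t => [_ [] //|t IH] tT i /=; rewrite mxE.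
case: unliftP => [j _|_]; first exact: IH (ltnW tT) j.
exact: query_ball (IH (ltnW tT)).
Qed.

Lemma query_at_ball f t : (t < T)%N -> dot (query_at f t) (query_at f t) <= r ^+ 2.
Proof.
move=> tT; have h := query_ball A tT (transcript_admissible f (ltnW tT)).
have r0 : 0 <= r by apply: le_trans h; rewrite sqrtr_ge0.
by rewrite -norm2_le.
Qed.

(** [n] is the length of a block of calls and [D] the dimension of the subspace in which each new
    vector is sought; [few] is the union bound over the [T] queries. *)
Variables (m n D : nat) (delta L mu : R).
Hypotheses (m_gt0 : (0 < m)%N) (n_gt0 : (0 < n)%N) (D_gt0 : (0 < D)%N).
Hypotheses (r_gt0 : 0 < r) (delta_gt0 : 0 < delta).
Hypotheses (dim : (D + (m + n) <= d)%N) (T_le : (T <= m * n)%N).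
Hypothesis few : T%:R * expR (- (delta ^+ 2 * D%:R / (8 * r ^+ 2))) < 1.

Let F (v : nat -> 'rV[R]_d) := hard m delta L mu v.

(* The state of the oracle after [k] stages of [n] queries each: [v i] is
   committed for [i < k] and still [0] for [i >= k]. *)
Definition stage_invariant (k : nat) (v : nat -> 'rV[R]_d) : Prop :=
  [/\ forall i, (k <= i)%N -> v i = 0,
      orthonormal_upto k v,
      forall j s, (j < k)%N -> (s < T)%N -> (j * n <= s < j.+1 * n)%N ->
        dot (v j) (query_at (F v) s) = 0,
      forall j s, (j < k)%N -> (s < T)%N -> (s < j * n)%N ->
        dot (v j) (query_at (F v) s) <= delta
    & k = m -> dot (v m.-1) (run A (F v)) = 0].

Lemma stage_step k v : (k < m)%N -> stage_invariant k v ->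
  exists v', stage_invariant k.+1 v'.
Proof.
move=> km [v0 vo vz vs _].
pose q s := query_at (F v) s.
(* At most [k + n + 1 <= m + n] constraints. The output is included at every stage, but the
   invariant records it only at the last one. *)
pose S := [seq v i | i <- iota 0 k] ++ [seq q s | s <- iota (k * n) n] ++ [:: run A (F v)].
have Sd : (D + size S <= d)%N.
  by rewrite !size_cat !size_map !size_iota /=; lia.
have [u [u1 uS uq]] := @near_orthogonal_unit R d D T S (fun s : 'I_T => q s) r delta
  D_gt0 Sd r_gt0 delta_gt0 (fun s : 'I_T => query_at_ball (F v) (ltn_ord s)) few.
have uv i : (i < k)%N -> dot u (v i) = 0.
  move=> ik; apply/uS; rewrite !mem_cat; apply/orP; left.
  by apply: map_f; rewrite mem_iota.
have uz s : (k * n <= s < k.+1 * n)%N -> dot u (q s) = 0.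
  move=> sk; apply/uS; rewrite !mem_cat; apply/orP; right; apply/orP; left.
  by apply: map_f; rewrite mem_iota; lia.
have ur : dot u (run A (F v)) = 0.
  by apply/uS; rewrite !mem_cat mem_seq1 eqxx !orbT.
pose v' i := if i == k then u else v i.
have v'k : v' k = u by rewrite /v' eqxx.
have v'i i : (i < k)%N -> v' i = v i by move=> ik; rewrite /v' ltn_eqF.
have same s : (s < k.+1 * n)%N -> (s < T)%N -> F v (q s) = F v' (q s).
  (* In the current block both [0] and [u] contribute inner product [0]; on an earlier block [j] the
     vector [v j] is orthogonal to the query and dominates coordinate [k]. *)
  move=> sk sT; have [ks|ks] := leqP (k * n) s.
    apply: hard_eq => i; rewrite /v'; case: eqP => // ->.
    by rewrite v0 // dot0l uz // ks.
  pose j := (s %/ n)%N.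
  have jk : (j < k)%N by rewrite ltn_divLR.
  have js : (j * n <= s < j.+1 * n)%N by rewrite leq_divM ltn_ceil.
  apply: (hard_local L mu m_gt0 delta_gt0 (j := j) (k := k)); first by rewrite jk.
  - by move=> i ik; rewrite /v' (negPf ik).
  - exact: vz.
  - by rewrite v0 // dot0l ltW.
  - by rewrite v'k; apply: (uq (Ordinal sT)).
have trE s : (s <= k.+1 * n)%N -> (s <= T)%N ->
    transcript A (F v) s = transcript A (F v') s.
  move=> sk sT; apply: transcript_eq => s' s's; apply: same; exact: leq_trans s's _.
have qE s : (s < k.+1 * n)%N -> (s < T)%N -> query_at (F v') s = q s.
  move=> sk sT; apply: (congr1 (@query _ _ _ _ A s)); apply/esym/trE; exact: ltnW.
exists v'; split.
- by move=> i ki; rewrite /v' gtn_eqF // v0 // ltnW.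
- move=> i j; rewrite !ltnS (leq_eqVlt i) (leq_eqVlt j).
  case: (eqVneq i k) => [->|ik] /=; case: (eqVneq j k) => [->|jk] //=.
  + by rewrite v'k u1.
  + by move=> _ jk'; rewrite v'k v'i // uv // eq_sym (negPf jk).
  + by move=> ik' _; rewrite v'k v'i // dotC uv // (negPf ik).
  + by move=> ik' jk'; rewrite !v'i // vo.
- move=> j s jk sT js; rewrite qE //; last by nia.
  move: jk; rewrite ltnS leq_eqVlt => /orP[/eqP jk|jk].
    by rewrite jk v'k uz // -jk.
  by rewrite v'i // vz.
- move=> j s jk sT js; rewrite qE //; last by nia.
  move: jk; rewrite ltnS leq_eqVlt => /orP[/eqP jk|jk].
    by rewrite jk v'k; apply: (uq (Ordinal sT)).
  by rewrite v'i // vs.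
(* After the last stage [T <= m * n] puts every call in a completed block, so the output on [F v']
   is the one made orthogonal to [u]. *)
- move=> km'; rewrite -km' /= v'k /run -trE //; last by rewrite km'.
Qed.

Lemma resisting_oracle : exists v : nat -> 'rV[R]_d,
  orthonormal_upto m v /\ dot (v m.-1) (run A (hard m delta L mu v)) = 0.
Proof.
have stages k : (k <= m)%N -> exists v, stage_invariant k v.
  elim: k => [_|k IH km]; last by have [v] := IH (ltnW km); exact: stage_step.
  exists (fun=> 0); split=> // k0; by move: m_gt0; rewrite -k0.
by have [v [_ vo _ _ vr]] := stages m (leqnn m); exists v; split; [|exact: vr].
Qed.

End Transcripts.

(** * Counting calls and dimensions *)

Lemma stages_cover (d m T : nat) : (T * 8 < d * m)%N -> (T <= m * (d %/ 8).+1)%N.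
Proof.
move=> h; rewrite -(@leq_pmul2r 8) // (leq_trans (ltnW h)) //.
by rewrite mulnC -mulnA leq_mul2l ltnW ?orbT // ltn_ceil.
Qed.

(** The fractions [1/2], [1/4] and [1/8] of [d] leave [d / 8] free, which absorbs the rounding once
    [d >= 16]. *)
Lemma dimensions_fit (d m : nat) : (16 <= d)%N -> (m * 4 <= d)%N ->
  (uphalf d + (m + (d %/ 8).+1) <= d)%N.
Proof. by move=> d16 md; have := uphalfK d; have := leq_divM d 8; lia. Qed.

(** The factor [1/48] in the hypothesis makes the exponent at least [3 * ln (e d)], and
    [T < d * m / 8 <= d ^ 2 / 32] is less than [(e d) ^ 3]. *)
Lemma few_calls (R : realType) (d m T : nat) : (16 <= d)%N -> (0 < m)%N ->
  m%:R <= d%:R / 4 :> R ->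
  m%:R ^+ 3 * ln (expR 1 * d%:R) <= (3 / 2 ^+ 14) ^+ 2 / 48 * d%:R :> R ->
  T%:R < d%:R * m%:R / 8 :> R ->
  T%:R * expR (- ((3 / 2 ^+ 14) ^+ 2 / m%:R ^+ 3 * (uphalf d)%:R / 8)) < 1 :> R.
Proof.
move=> d16 m0 md hm hT.
have d0 : 0 < d%:R :> R by rewrite ltr0n; lia.
have d1 : 1 <= d%:R :> R by rewrite ler1n; lia.
have mR : 0 < m%:R :> R by rewrite ltr0n.
set B : R := (3 / 2 ^+ 14) ^+ 2 in hm *.
have B0 : 0 < B by rewrite exprn_gt0 // divr_gt0 // exprn_gt0.
pose E := expR 1 * d%:R : R.
have E0 : 0 < E by rewrite mulr_gt0 ?expR_gt0.
have dE : d%:R <= E.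
  by rewrite -[X in X <= _]mul1r ler_pM2r // -[X in X <= _]expR0 ler_expR.
have hd : d%:R / 2 <= (uphalf d)%:R :> R.
  by rewrite ler_pdivrMr // -natrM ler_nat muln2 uphalfK leq_addl.
have key : 3 * ln E <= B / m%:R ^+ 3 * (uphalf d)%:R / 8.
  apply: (@le_trans _ _ (B / m%:R ^+ 3 * (d%:R / 2) / 8)); last first.
    by rewrite ler_pM2r ?invr_gt0 // ler_pM2l // divr_gt0 // exprn_gt0.
  have -> : B / m%:R ^+ 3 * (d%:R / 2) / 8 = 3 * ((B / 48 * d%:R) / m%:R ^+ 3).
    by field; rewrite gt_eqF.
  by rewrite ler_pM2l // ler_pdivlMr ?exprn_gt0 // mulrC.
apply: (@le_lt_trans _ _ (T%:R * expR (- (3 * ln E)))).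
  by rewrite ler_wpM2l // ler_expR lerN2.
rewrite expRN expRM_natl lnK ?posrE // ltr_pdivrMr ?exprn_gt0 // mul1r.
apply: (lt_le_trans hT).
apply: (@le_trans _ _ (d%:R ^+ 3)); last by rewrite lerXn2r ?nnegrE ?(ltW d0) ?(ltW E0).
have : d%:R * m%:R <= d%:R * (d%:R / 4) :> R by rewrite ler_pM2l.
have : d%:R ^+ 2 <= d%:R ^+ 3 :> R by rewrite ler_weXn2l.
rewrite expr2; have := mulr_gt0 d0 d0; lra.
Qed.

Theorem theorem3p4 (R : realType) :
  exists (c0 : R) (d0 : nat), [/\ 0 < c0, (0 < d0)%N &
    forall r beta : R, 0 < r -> 0 < beta ->
    forall d m : nat, (d0 <= d)%N ->
      (1 <= m)%N -> m%:R <= d%:R / 4 :> R ->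
      m%:R ^+ 3 * ln (expR 1 * d%:R) <= c0 * d%:R ->
    forall T : nat, T%:R < d%:R * m%:R / 8 :> R ->
    forall A : algorithm d r T,
    exists (F : 'rV[R]_d -> R) (xstar : 'rV[R]_d),
      [/\ objective_class d r beta F,
          is_global_minimizer F xstar,
          F (run A F) - F xstar >= 2 ^- 17 * (beta * r ^+ 2 / m%:R ^+ 2),
          strongly_convex (beta / (4096 * m%:R ^+ 2)) F
        & strong_convexity_modulus F (beta / (4096 * m%:R ^+ 2))]].
Proof.
exists ((3 / 2 ^+ 14) ^+ 2 / 48), 16%N; split=> //.
move=> r beta r0 b0 d m d16 m0 md hm T hT A.
have -> : 4096 = 2 ^+ 12 :> R by rewrite -natrX.
have mR : 0 < m%:R :> R by rewrite ltr0n.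
have m1 : 1 <= m%:R :> R by rewrite ler1n.
have md4 : (m * 4 <= d)%N.
  by move: md; rewrite ler_pdivlMr // -natrM ler_nat.
pose sm : R := Num.sqrt m%:R.
have sm0 : 0 < sm by rewrite sqrtr_gt0.
have sm2 : m%:R = sm ^+ 2 by rewrite sqr_sqrtr // ltW.
(* The value of [mu] is prescribed. The other two give [L / delta = beta / 2], leaving room for [mu]
   in the smoothness bound, and [L / mu = 3 / 8 * r * sm], which places the minimiser at norm about
   [3 / 8 * r]. *)
pose delta : R := 3 / 2 ^+ 14 * r / sm ^+ 3.
pose L : R := 3 / 2 ^+ 15 * (beta * r) / sm ^+ 3.
pose mu : R := beta / (2 ^+ 12 * m%:R ^+ 2).
have delta0 : 0 < delta by rewrite divr_gt0 ?exprn_gt0 // mulr_gt0 // divr_gt0 // exprn_gt0.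
have L0 : 0 < L by rewrite divr_gt0 ?exprn_gt0 // mulr_gt0 ?mulr_gt0 // divr_gt0 // exprn_gt0.
have mu0 : 0 < mu by rewrite divr_gt0 // mulr_gt0 ?exprn_gt0.
have few : T%:R * expR (- (delta ^+ 2 * (uphalf d)%:R / (8 * r ^+ 2))) < 1.
  have := few_calls d16 m0 md hm hT.
  rewrite (_ : (3 / 2 ^+ 14) ^+ 2 / m%:R ^+ 3 * (uphalf d)%:R / 8 =
    delta ^+ 2 * (uphalf d)%:R / (8 * r ^+ 2)) //.
  by rewrite /delta sm2; field; rewrite !gt_eqF.
have Tn : (T <= m * (d %/ 8).+1)%N.
  have h1 : (T * 8 < d * m)%N.
    by move: hT; rewrite ltr_pdivlMr // -!natrM ltr_nat.
  exact: stages_cover.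
have hD := dimensions_fit d16 md4.
have D0 : (0 < uphalf d)%N by rewrite uphalf_gt0 (leq_trans _ d16).
have [v [vo vr]] := @resisting_oracle R d T r A m (d %/ 8).+1 (uphalf d) delta L mu
  m0 (ltn0Sn _) D0 r0 delta0 hD Tn few.
pose F := hard m delta L mu v.
have LmuE : L / mu = 3 / 8 * r * sm.
  by rewrite /L /mu sm2; field; rewrite !gt_eqF.
have gap_ok : 2 * m%:R ^+ 2 * delta <= L / mu.
  have -> : 2 * m%:R ^+ 2 * delta = 3 / 2 ^+ 13 * (r * sm).
    by rewrite /delta sm2; field; rewrite !gt_eqF.
  rewrite LmuE -(mulrA (3 / 8) r sm) ler_pM2r ?mulr_gt0 //; lra.
have smooth : L / delta + mu <= beta.
  have -> : L / delta = beta / 2.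
    by rewrite /L /delta; field; rewrite !gt_eqF.
  suff : mu <= beta / 2 ^+ 12 by lra.
  rewrite /mu ler_pM2l // lef_pV2 ?posrE ?mulr_gt0 ?exprn_gt0 //.
  by rewrite -[X in X <= _]mulr1 ler_pM2l // expr_ge1 // ltW.
pose xs := hard_min m delta L mu v.
have min_xs := hard_min_minimizer m0 delta0 L0 mu0 vo gap_ok.
have gE : gradient F = hard_grad m delta L mu v.
  by apply/funext => x; have [] := hard_differentiable m0 delta0 L0 mu0 vo x.
have weights_ub i : min_weights m delta L mu ord0 i <= (1 + 1 / 2 ^+ 10) / m%:R.
  have := min_weights_dev m0 delta0 L0 mu0 i; rewrite ler_norml => /andP[_].
  have -> : 2 * m%:R * delta / (L / mu) = 1 / 2 ^+ 10 / m%:R.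
    by rewrite LmuE /delta sm2; field; rewrite !gt_eqF.
  lra.
exists F, xs; split.
- split.
  + apply: (@convex_function_subgradient _ _ _ (hard_grad m delta L mu v)) => x y.
    apply: le_trans (hard_subgradient mu m0 delta0 L0 v x y).
    by rewrite lerDl mulr_ge0 ?dot_ge0 // divr_ge0 // ltW.
  + by move=> x; have [] := hard_differentiable m0 delta0 L0 mu0 vo x.
  + have lip0 : 0 <= L / delta + mu.
      exact: addr_ge0 (divr_ge0 (ltW L0) (ltW delta0)) (ltW mu0).
    rewrite gE.
    exact: (lipschitz_norm2_continuous lip0 (hard_grad_lipschitz m0 delta0 L0 mu0 vo)).
  + move=> x y; rewrite gE; apply: le_trans (hard_grad_lipschitz m0 delta0 L0 mu0 vo x y) _.
    by rewrite ler_wpM2r // sqrtr_ge0.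
  + exists xs; split; first by split=> // y; exact: hard_min_unique.
    rewrite /ball2 /= norm2_le; last by rewrite divr_ge0 // ltW.
    apply: le_trans (hard_min_dot m0 delta0 L0 mu0 vo gap_ok weights_ub) _.
    (* The weights exceed [1 / m] by a factor of at most [1 + 2^-10], so the norm of the minimiser
       stays below [r / 2]. *)
    have e : (3 / 8 * r * sm) ^+ 2 * (m%:R * ((1 + 1 / 2 ^+ 10) / m%:R) ^+ 2) =
        (3 / 8 * (1 + 1 / 2 ^+ 10)) ^+ 2 * r ^+ 2.
      by rewrite sm2; field; rewrite gt_eqF.
    have -> : (r / 2) ^+ 2 = 1 / 4 * r ^+ 2 by field.
    rewrite LmuE e ler_wpM2r ?sqr_ge0 //; lra.
- exact: min_xs.
(* The choice [s = L / (mu * m)] maximises [L * s - mu / 2 * m * s ^+ 2], with value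
   [9 / 2 ^ 19 * Q]. The smoothing and offset losses are of order [2 ^- 25 * Q], so more than
   [2 ^- 17 * Q] is left. *)
- apply: le_trans (hard_gap m0 delta0 L0 mu0 vo gap_ok vr (s := 3 / 8 * r / sm) _); last first.
    by rewrite divr_ge0 ?(ltW sm0) // mulr_ge0 // ltW.
  pose Q := beta * r ^+ 2 / m%:R ^+ 2.
  have Q0 : 0 < Q by rewrite divr_gt0 ?exprn_gt0 // mulr_gt0 // exprn_gt0.
  have e1 : L * (3 / 8 * r / sm) = 9 / 2 ^+ 18 * Q.
    by rewrite /L /Q sm2; field; rewrite gt_eqF.
  have e2 : L * delta * m%:R = 9 / 2 ^+ 29 * Q.
    by rewrite /L /delta /Q sm2; field; rewrite gt_eqF.
  have e3 : mu / 2 * (m%:R * (3 / 8 * r / sm) ^+ 2) = 9 / 2 ^+ 19 * Q.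
    by rewrite /mu /Q sm2; field; rewrite gt_eqF.
  have e4 : L * delta <= L * delta * m%:R by rewrite ler_peMr // mulr_ge0 // ltW.
  rewrite e1 e3 -/Q; move: (L * delta) e2 e4 => ld e2 e4; lra.
- exact: hard_strongly_convex.
- apply: hard_modulus => //; apply: leq_trans md4.
  by rewrite -[X in (X < _)%N]muln1 ltn_pmul2l.
Qed.
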